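(* Let $\mathcal{C}=\mathbb{Z}P^1\cup\mathbb{Z}P^1=\{e_{\vec a},e_{\vec a}^{-1}\}\subset SL_2(\mathbb{Z})$, where $\vec a$ ranges over pairs $(a,c)\in\mathbb{Z}^2$ of coprime integers modulo overall sign and \[ e_{(a,c)}=\begin{pmatrix}1-ac & a^2\\ -c^2 & 1+ac\end{pmatrix},\qquad e_{(a,c)}^{-1}=\begin{pmatrix}1+ac & -a^2\\ c^2 & 1-ac\end{pmatrix},\] regarded as an IP-quandle under conjugation and inversion in $SL_2(\mathbb{Z})$. Then the IP-quandle $\mathcal{C}$ is locally skew. Moreover, the associated group $G_{\mathcal{C}}$ is isomorphic to $B_3$, the braid group on $3$ strands.
   Context: The pairs $(\pm1,0)$ and $(0,\pm1)$ count as coprime. The set $\mathcal{C}$ is the union of the conjugacy classes in $SL_2(\mathbb{Z})$ of $\begin{pmatrix}1&1\\0&1\end{pmatrix}$ and $\begin{pmatrix}1&0\\1&1\end{pmatrix}$. A (left) IP-quandle is a set $\mathcal{C}$ with an operation $(a,b)\mapsto {}^ab$ such that ${}^a({}^bc)={}^{({}^ab)}({}^ac)$, each map ${}^a(\ )$ is bijective, ${}^aa=a$, together with a permutation $a\mapsto a^{-1}$ of $\mathcal{C}$ such that $(a^{-1})^{-1}=a$, ${}^a(b^{-1})=({}^ab)^{-1}$ and ${}^{a^{-1}}({}^ab)=b$ for all $a,b,c\in\mathcal{C}$. A subset $\mathcal{C}\subseteq G\setminus\{e\}$ of a group $G$ stable under conjugation and inversion is an IP-quandle with ${}^ab=aba^{-1}$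 and group inversion. The group $G_{\mathcal{C}}$ associated to an IP-quandle $\mathcal{C}$ is generated by $\mathcal{C}$ with relations ${}^ab\,a=ab$ and $a^{-1}a=e$ for all $a,b\in\mathcal{C}$ (here $a^{-1}$ denotes the generator given by the permutation of $\mathcal C$). Two elements $a,b\in\mathcal{C}$ are mutually skew if ${}^ab=({}^ba)^{-1}$. The IP-quandle $\mathcal{C}$ is locally skew if the graph with vertex set $\mathcal{C}$ and an edge between two distinct elements whenever they are mutually skew is connected. *)

(* Defs.v *)
From HB Require Import structures.
From mathcomp Require Import all_boot all_order all_algebra generic_quotient.
From mathcomp Require Import boolp.
From mathcomp Require Import ring.

Set Implicit Arguments.
Unset Strict Implicit.
Unset Printing Implicit Defensive.

Import GRing.Theory.

Local Open Scope group_scope.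
Local Open Scope quotient_scope.

(* Groups given by generators and relations.  A word is a sequence of letters, where
   [(x, false)] stands for the generator [x] and [(x, true)] for its formal
   inverse.  The presented group is the quotient of the words by the smallest
   congruence containing the free cancellations and the given relations. *)

Definition word (X : Type) := seq (X * bool).

Definition letter (X : Type) (x : X) : word X := [:: (x, false)].

Definition word_inv (X : Type) (w : word X) : word X :=
  rev [seq (l.1, ~~ l.2) | l <- w].

Inductive pres_eq (X : Type) (rels : word X -> word X -> Prop) :
    word X -> word X -> Prop :=
| PresRefl u : pres_eq rels u u
| PresSym u v : pres_eq rels u v -> pres_eq rels v u
| PresTrans u v w : pres_eq rels u v -> pres_eq rels v w -> pres_eq rels u w
| PresCat u u' v v' : pres_eq rels u u' -> pres_eq rels v v' ->
    pres_eq rels (u ++ v) (u' ++ v')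
| PresCancel x b : pres_eq rels [:: (x, b); (x, ~~ b)] [::]
| PresRel u v : rels u v -> pres_eq rels u v.

Section PresentedGroup.
Variables (X : choiceType) (rels : word X -> word X -> Prop).

Definition pres_eqb : rel (word X) := fun u v => `[< pres_eq rels u v >].

Fact pres_eqb_equiv : equiv_class_of pres_eqb.
Proof.
split=> [u|u v|v u w].
- exact/asboolP/PresRefl.
- by apply/asboolP/asboolP; apply: PresSym.
- by move=> /asboolP uv /asboolP vw; apply/asboolP; apply: PresTrans vw.
Qed.

Canonical pres_eqb_rel := EquivRelPack pres_eqb_equiv.

Definition presented_group := {eq_quot pres_eqb_rel}.

HB.instance Definition _ := EqQuotient.on presented_group.
HB.instance Definition _ := Choice.on presented_group.

Definition pres_class (u : word X) : presented_group := \pi u.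

Lemma pres_classP (u v : word X) :
  pres_class u = pres_class v <-> pres_eq rels u v.
Proof.
split=> [/eqmodP /asboolP //|uv].
by apply/eqmodP/asboolP.
Qed.

Lemma pres_reprK (x : presented_group) : pres_class (repr x) = x.
Proof. exact: reprK. Qed.

Lemma pres_repr (u : word X) : pres_eq rels (repr (pres_class u)) u.
Proof. by apply/pres_classP; rewrite pres_reprK. Qed.

Lemma presW (P : presented_group -> Prop) :
  (forall u, P (pres_class u)) -> forall x, P x.
Proof. by move=> Pu x; rewrite -(pres_reprK x). Qed.

Lemma word_inv_cat (u v : word X) :
  word_inv (u ++ v) = word_inv v ++ word_inv u.
Proof. by rewrite /word_inv map_cat rev_cat. Qed.

Lemma word_invK : involutive (@word_inv X).
Proof.
move=> u; rewrite /word_inv map_rev revK -map_comp map_id_in // => -[x b] _.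
by rewrite /= negbK.
Qed.

Lemma pres_mulV (u : word X) : pres_eq rels (u ++ word_inv u) [::].
Proof.
elim: u => [|[x b] u IHu]; first exact: PresRefl.
rewrite -cat1s word_inv_cat -catA [u ++ _]catA.
apply: PresTrans (PresCancel rels x b).
exact: (PresCat (PresRefl _ [:: (x, b)])
          (PresCat IHu (PresRefl _ [:: (x, ~~ b)]))).
Qed.

Lemma pres_Vmul (u : word X) : pres_eq rels (word_inv u ++ u) [::].
Proof. by have := pres_mulV (word_inv u); rewrite word_invK. Qed.

Lemma pres_inv (u v : word X) :
  pres_eq rels u v -> pres_eq rels (word_inv u) (word_inv v).
Proof.
move=> uv.
have uvV : pres_eq rels (u ++ word_inv v) [::].
  exact: PresTrans (PresCat uv (PresRefl _ _)) (pres_mulV v).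
have /PresSym := PresCat (PresRefl rels (word_inv u)) uvV.
rewrite cats0 => /PresTrans; apply; rewrite catA.
exact: (PresCat (pres_Vmul u) (PresRefl _ _)).
Qed.

Definition pres_one : presented_group := pres_class [::].
Definition pres_mul (x y : presented_group) : presented_group :=
  pres_class (repr x ++ repr y).
Definition pres_invg (x : presented_group) : presented_group :=
  pres_class (word_inv (repr x)).

Lemma pres_mulE (u v : word X) :
  pres_mul (pres_class u) (pres_class v) = pres_class (u ++ v).
Proof. by apply/pres_classP/PresCat; apply: pres_repr. Qed.

Lemma pres_invE (u : word X) : pres_invg (pres_class u) = pres_class (word_inv u).
Proof. by apply/pres_classP/pres_inv/pres_repr. Qed.

Fact pres_mulA : associative pres_mul.
Proof.
by elim/presW=> u; elim/presW=> v; elim/presW=> w; rewrite !pres_mulE catA.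
Qed.

Fact pres_mul1g : left_id pres_one pres_mul.
Proof. by elim/presW=> u; rewrite pres_mulE. Qed.

Fact pres_mulg1 : right_id pres_one pres_mul.
Proof. by elim/presW=> u; rewrite pres_mulE cats0. Qed.

Fact pres_mulVg : left_inverse pres_one pres_invg pres_mul.
Proof.
elim/presW=> u; rewrite pres_invE pres_mulE.
exact/pres_classP/pres_Vmul.
Qed.

Fact pres_mulgV : right_inverse pres_one pres_invg pres_mul.
Proof.
elim/presW=> u; rewrite pres_invE pres_mulE.
exact/pres_classP/pres_mulV.
Qed.

HB.instance Definition _ := isGroup.Build presented_group
  pres_mulA pres_mul1g pres_mulg1 pres_mulVg pres_mulgV.

End PresentedGroup.

Definition isomorphic_groups (G H : groupType) : Prop :=
  exists f : {multiplicative G -> H}, bijective f.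

(* The generators s_1, ..., s_(n-1) are indexed from 0. *)
Inductive braid_rels (n : nat) : word 'I_n.-1 -> word 'I_n.-1 -> Prop :=
| BraidFar (i j : 'I_n.-1) : (i.+1 < j)%N ->
    braid_rels (letter i ++ letter j) (letter j ++ letter i)
| BraidAdjacent (i j : 'I_n.-1) : j = i.+1 :> nat ->
    braid_rels (letter i ++ letter j ++ letter i)
               (letter j ++ letter i ++ letter j).

Definition braid_group (n : nat) : groupType := presented_group (@braid_rels n).

(* [qact a b] is the left action written with a superscript a to the left
   of b. *)
HB.mixin Record isIPQuandle Q of Choice Q := {
  qact : Q -> Q -> Q;
  qinv : Q -> Q;
  qactA : forall a b c, qact a (qact b c) = qact (qact a b) (qact a c);
  qact_bij : forall a, bijective (qact a);
  qactxx : forall a, qact a a = a;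
  qinvK : involutive qinv;
  qactV : forall a b, qact a (qinv b) = qinv (qact a b);
  qactVK : forall a b, qact (qinv a) (qact a b) = b
}.

#[short(type="ipQuandleType")]
HB.structure Definition IPQuandle := {Q of isIPQuandle Q & Choice Q}.

(* The group attached to Q: generator [qinv a] is forced to be the inverse of
   generator [a]. *)
Inductive ipq_rels (Q : ipQuandleType) : word Q -> word Q -> Prop :=
| IPQConj (a b : Q) :
    ipq_rels (letter (qact a b) ++ letter a) (letter a ++ letter b)
| IPQInv (a : Q) : ipq_rels (letter (qinv a) ++ letter a) [::].

Definition ipq_group (Q : ipQuandleType) : groupType :=
  presented_group (@ipq_rels Q).

Definition mutually_skew (Q : ipQuandleType) (a b : Q) : bool :=
  qact a b == qinv (qact b a).

Lemma mutually_skewC (Q : ipQuandleType) : symmetric (@mutually_skew Q).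
Proof.
move=> a b; rewrite /mutually_skew.
by rewrite eq_sym (inv_eq (@qinvK Q)).
Qed.

Definition skew_edge (Q : ipQuandleType) : rel Q :=
  fun a b => (a != b) && mutually_skew a b.

Definition locally_skew (Q : ipQuandleType) : Prop :=
  forall a b : Q, exists p : seq Q, path (@skew_edge Q) a p /\ last a p = b.

Record conj_inv_stable (G : groupType) (S : {pred G}) : Prop := ConjInvStable {
  stable1 : 1 \notin S;
  stableJ : forall g x : G, x \in S -> g * x * g^-1 \in S;
  stableV : forall x : G, x \in S -> x^-1 \in S
}.

(* The unused proof argument is what lets the canonical IP-quandle structure be
   inferred from the type. *)
Definition conj_quandle (G : groupType) (S : {pred G})
  (_ : conj_inv_stable S) : Type := {x : G | x \in S}.

Section ConjQuandle.
Variables (G : groupType) (S : {pred G}) (stS : conj_inv_stable S).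

Local Notation Q := (conj_quandle stS).

HB.instance Definition _ := Choice.copy Q {x : G | x \in S}.
HB.instance Definition _ := SubType.copy Q {x : G | x \in S}.

Definition conj_qact (a b : Q) : Q :=
  exist _ (val a * val b * (val a)^-1) (stableJ stS (val a) (valP b)).

Definition conj_qinv (a : Q) : Q := exist _ (val a)^-1 (stableV stS (valP a)).

Fact conj_qactA a b c :
  conj_qact a (conj_qact b c) = conj_qact (conj_qact a b) (conj_qact a c).
Proof. by apply: val_inj; rewrite /= !invgM !invgK !mulgA !mulgVK. Qed.

Fact conj_qactVK a b : conj_qact (conj_qinv a) (conj_qact a b) = b.
Proof. by apply: val_inj; rewrite /= invgK !mulgA mulVg mul1g mulgVK. Qed.

Fact conj_qinvK : involutive conj_qinv.
Proof. by move=> a; apply: val_inj; rewrite /= invgK. Qed.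

Fact conj_qact_bij a : bijective (conj_qact a).
Proof.
exists (conj_qact (conj_qinv a)); first exact: conj_qactVK.
by move=> b; have := conj_qactVK (conj_qinv a) b; rewrite conj_qinvK.
Qed.

Fact conj_qactxx a : conj_qact a a = a.
Proof. by apply: val_inj; rewrite /= mulgK. Qed.

Fact conj_qactV a b : conj_qact a (conj_qinv b) = conj_qinv (conj_qact a b).
Proof. by apply: val_inj; rewrite /= !invgM invgK mulgA. Qed.

HB.instance Definition _ := isIPQuandle.Build Q
  conj_qactA conj_qact_bij conj_qactxx conj_qinvK conj_qactV conj_qactVK.

End ConjQuandle.

Local Open Scope ring_scope.

Record SL (n : nat) (R : comNzRingType) := MkSL {
  slval :> 'M[R]_n;
  _ : \det slval == 1
}.

Section SpecialLinear.
Variables (n : nat) (R : comNzRingType).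

HB.instance Definition _ := [isSub for @slval n R].
HB.instance Definition _ := [Choice of SL n R by <:].

Lemma det_SL (A : SL n R) : \det A = 1.
Proof. exact/eqP/(valP A). Qed.

Fact SL_one_subproof : \det (1%:M : 'M[R]_n) == 1.
Proof. by rewrite det1. Qed.

Fact SL_mul_subproof (A B : SL n R) : \det (A *m B) == 1.
Proof. by rewrite det_mulmx !det_SL mulr1. Qed.

Fact SL_inv_subproof (A : SL n R) : \det (\adj A) == 1.
Proof.
by rewrite -[\det _]mul1r -{1}(det_SL A) -det_mulmx mul_mx_adj det_SL det1.
Qed.

Definition SL_one : SL n R := MkSL SL_one_subproof.
Definition SL_mul (A B : SL n R) : SL n R := MkSL (SL_mul_subproof A B).
Definition SL_inv (A : SL n R) : SL n R := MkSL (SL_inv_subproof A).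

Fact SL_mulA : associative SL_mul.
Proof. by move=> A B C; apply: val_inj; rewrite /= mulmxA. Qed.

Fact SL_mul1g : left_id SL_one SL_mul.
Proof. by move=> A; apply: val_inj; rewrite /= mul1mx. Qed.

Fact SL_mulg1 : right_id SL_one SL_mul.
Proof. by move=> A; apply: val_inj; rewrite /= mulmx1. Qed.

Fact SL_mulVg : left_inverse SL_one SL_inv SL_mul.
Proof. by move=> A; apply: val_inj; rewrite /= mul_adj_mx det_SL. Qed.

Fact SL_mulgV : right_inverse SL_one SL_inv SL_mul.
Proof. by move=> A; apply: val_inj; rewrite /= mul_mx_adj det_SL. Qed.

HB.instance Definition _ := isGroup.Build (SL n R)
  SL_mulA SL_mul1g SL_mulg1 SL_mulVg SL_mulgV.

End SpecialLinear.

Definition mx22 (R : Type) (a b c d : R) : 'M[R]_2 :=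
  \matrix_(i < 2, j < 2)
    if i == 0 then (if j == 0 then a else b) else (if j == 0 then c else d).

Lemma det_mx22 (R : comNzRingType) (A : 'M[R]_2) :
  \det A = A 0 0 * A 1 1 - A 0 1 * A 1 0.
Proof.
rewrite (expand_det_row _ 0) !big_ord_recl big_ord0 addr0 /cofactor.
rewrite !det_mx11 !mxE /= expr0 expr1 mul1r mulN1r mulrN.
by congr (A _ _ * A _ _ - A _ _ * A _ _); apply: val_inj.
Qed.

Lemma det_mx22E (R : comNzRingType) (a b c d : R) :
  \det (mx22 a b c d) = a * d - b * c.
Proof. by rewrite det_mx22 !mxE. Qed.

Lemma mx22P (R : Type) (A B : 'M[R]_2) :
  A 0 0 = B 0 0 -> A 0 1 = B 0 1 -> A 1 0 = B 1 0 -> A 1 1 = B 1 1 -> A = B.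
Proof.
move=> e00 e01 e10 e11; apply/matrixP=> i j.
have ord2 (k : 'I_2) : k = 0 \/ k = 1.
  by case: k => [[|[|//]] lt_k]; [left|right]; apply: val_inj.
by case: (ord2 i) => ->; case: (ord2 j) => ->.
Qed.

Fact evec_subproof (a c : int) :
  \det (mx22 (1 - a * c) (a ^+ 2) (- c ^+ 2) (1 + a * c)) == 1.
Proof. by apply/eqP; rewrite det_mx22E; ring. Qed.

Definition evec (a c : int) : SL 2 int := MkSL (evec_subproof a c).

Lemma evecN (a c : int) : evec (- a) (- c) = evec a c.
Proof. by apply: val_inj; apply: mx22P; rewrite !mxE /=; ring. Qed.

Lemma mulSLE (A B : SL 2 int) i j :
  (A * B)%g i j = A i 0 * B 0 j + A i 1 * B 1 j.
Proof.
rewrite mxE !big_ord_recl big_ord0 addr0.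
by rewrite (_ : lift _ _ = 1) //; apply: val_inj.
Qed.

Lemma oneSLE i j : (1%g : SL 2 int) i j = (i == j)%:R.
Proof. by rewrite mxE. Qed.

Lemma evecV (a c : int) :
  slval (evec a c)^-1%g =
    mx22 (1 + a * c) (- a ^+ 2) (c ^+ 2) (1 - a * c).
Proof.
have dB : \det (mx22 (1 + a * c) (- a ^+ 2) (c ^+ 2) (1 - a * c)) == 1.
  by apply/eqP; rewrite det_mx22E; ring.
rewrite (@mulg1_eq _ _ (MkSL dB)) //; apply: val_inj.
by apply: mx22P; rewrite mulSLE oneSLE !mxE /=; ring.
Qed.

(* [coprimez] accepts (+-1, 0) and (0, +-1), and rejects (0, 0). *)
Definition ZP1_set : {pred SL 2 int} :=
  fun A => `[< exists a c : int,
                 coprimez a c /\ (A = evec a c \/ A = (evec a c)^-1%g) >].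

Lemma evecJ (g : SL 2 int) (a c : int) :
  (g * evec a c * g^-1)%g =
    evec (g 0 0 * a + g 0 1 * c) (g 1 0 * a + g 1 1 * c).
Proof.
apply: (mulIg g); rewrite mulgVK; apply: val_inj.
have := det_SL g; rewrite det_mx22 => dg.
have lin (k x y u v : int) : u = v -> x - y = k * (u - v) -> x = y.
  by move=> ->; rewrite subrr mulr0 => /subr0_eq.
apply: mx22P; rewrite !mulSLE !mxE /=;
  move: (g 0 0) (g 0 1) (g 1 0) (g 1 1) dg => p q r s dg.
- by apply: (lin ((p * a + q * c) * c) _ _ _ _ dg); ring.
- by apply: (lin (- (p * a + q * c) * a) _ _ _ _ dg); ring.
- by apply: (lin ((r * a + s * c) * c) _ _ _ _ dg); ring.
- by apply: (lin (- (r * a + s * c) * a) _ _ _ _ dg); ring.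
Qed.

Lemma coprime_SL (g : SL 2 int) (a c : int) : coprimez a c ->
  coprimez (g 0 0 * a + g 0 1 * c) (g 1 0 * a + g 1 1 * c).
Proof.
move=> /coprimezP[[u v] /= uv]; apply/coprimezP.
exists (u * g 1 1 - v * g 1 0, v * g 0 0 - u * g 0 1) => /=.
have := det_SL g; rewrite det_mx22 => dg.
by rewrite -[RHS]mulr1 -{1}uv -dg; ring.
Qed.

Lemma ZP1_set_stable : conj_inv_stable ZP1_set.
Proof.
split.
- apply/negP=> /asboolP[a [c [co_ac eq1]]].
  have {eq1} e1 : evec a c = 1%g.
    by case: eq1 => e1; last apply: invg_inj; rewrite -e1 ?invg1.
  have : (evec a c) 0 1 = 0 by rewrite e1 oneSLE.
  have : (evec a c) 1 0 = 0 by rewrite e1 oneSLE.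
  rewrite !mxE /= => /eqP; rewrite oppr_eq0 expf_eq0 /= => /eqP c0.
  by move=> /eqP; rewrite expf_eq0 /= => /eqP a0; rewrite a0 c0 in co_ac.
- move=> g A /asboolP[a [c [co_ac eA]]]; apply/asboolP.
  exists (g 0 0 * a + g 0 1 * c), (g 1 0 * a + g 1 1 * c).
  split; first exact: coprime_SL.
  rewrite -evecJ; case: eA => ->; [by left | right].
  by rewrite !invgM invgK mulgA.
- move=> A /asboolP[a [c [co_ac eA]]]; apply/asboolP; exists a, c; split=> //.
  by case: eA => ->; rewrite ?invgK; [right|left].
Qed.

Definition ZP1_quandle : ipQuandleType := conj_quandle ZP1_set_stable.

(* The other description of the same set: the union of the conjugacy classes
   of the two elementary matrices. *)
Fact upper_subproof : \det (mx22 1 1 0 1 : 'M[int]_2) == 1.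
Proof. by rewrite det_mx22E. Qed.

Fact lower_subproof : \det (mx22 1 0 1 1 : 'M[int]_2) == 1.
Proof. by rewrite det_mx22E. Qed.

Definition upper_unip : SL 2 int := MkSL upper_subproof.
Definition lower_unip : SL 2 int := MkSL lower_subproof.

Lemma upper_unipE : upper_unip = evec 1 0.
Proof. by apply: val_inj; apply: mx22P; rewrite !mxE. Qed.

Lemma lower_unipE : lower_unip = (evec 0 1)^-1%g.
Proof. by apply: val_inj; rewrite [RHS]evecV; apply: mx22P; rewrite !mxE. Qed.

Lemma ZP1_setE (A : SL 2 int) :
  A \in ZP1_set <-> exists g : SL 2 int,
    (A = g * upper_unip * g^-1 \/ A = g * lower_unip * g^-1)%g.
Proof.
split; last first.
  case=> g []->; apply: (stableJ ZP1_set_stable); apply/asboolP.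
    by exists 1, 0; split=> //; left; rewrite upper_unipE.
  by exists 0, 1; split=> //; right; rewrite lower_unipE.
case/asboolP=> a [c [/coprimezP[[u v] /= uv] eA]].
case: eA => ->.
  have dg : \det (mx22 a (- v) c u) == 1.
    by apply/eqP; rewrite det_mx22E -uv; ring.
  exists (MkSL dg); left; rewrite upper_unipE evecJ !mxE /=.
  by rewrite !mulr1 !mulr0 !addr0.
have dg : \det (mx22 v a (- u) c) == 1.
  by apply/eqP; rewrite det_mx22E -uv; ring.
exists (MkSL dg); right; rewrite lower_unipE.
rewrite -{1}[MkSL dg]invgK -!invgM mulgA evecJ !mxE /=.
by rewrite !mulr1 !mulr0 !add0r.
Qed.

(* Main.v *)
From HB Require Import structures.
From mathcomp Require Import all_boot all_order all_algebra.
From mathcomp Require Import boolp.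
From mathcomp Require Import ring zify.
Require Import Defs.

Set Implicit Arguments.
Unset Strict Implicit.
Unset Printing Implicit Defensive.

Import GRing.Theory.
Local Open Scope group_scope.

(** Sending the standard braid generators s1, s2 to e_(1,0), e_(0,1) defines a
    surjection from B_3 to SL_2(Z) whose kernel is generated by the central
    element (s1 s2)^6.  Two conjugates of s1 with the same image differ by an
    element of the kernel, which has exponent sum 0 and is therefore trivial.  So
    the conjugacy class of s1 in B_3 maps bijectively onto the set of all e_v: each
    e_v has a canonical lift to B_3, and conjugating lifts is the same as
    conjugating matrices.  Hence v |-> lift of e_v respects the relations of the
    group of the quandle and induces a morphism to B_3, whose inverse sends s1, s2
    to the generators attached to e_(1,0), e_(0,1).

    Rather than computing the kernel, the proof builds the lift by hand, in any
    group with elements x, y such that xyx = yxy ([farey_lift]).  On vectors with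
    nonnegative coprime coordinates the Euclidean algorithm forces its value, as such a
    vector is reached from (1,0) or (0,1) by the maps (a,c) |-> (a+c,c), which is
    e_(1,0), and (a,c) |-> (a,a+c), which is the inverse of e_(0,1).  The product
    e_(1,0) e_(0,1) e_(1,0) is the rotation (a,c) |-> (c,-a), which exchanges this
    quadrant with the other one up to sign, so conjugation by xyx extends the lift
    to all primitive vectors.  The substance is that the result is equivariant under both
    generators ([farey_lift_shear], [farey_lift_coshear]).

    Everything else is an induction over the quandle, which is generated by
    e_(1,0) under the action of e_(1,0) and e_(0,1) and inversion ([evecq_ind],
    the Euclidean algorithm again).  Local skewness
    ([braid_generated_locally_skew]) holds for any IP-quandle generated in this
    way, and the group is B_3 ([braid_generated_iso]) as soon as an equivariant
    lift to B_3 exists.  For local skewness, e_(1,0) is skew to the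
    inverse of e_(0,1), every element is skew to its inverse, and the action
    preserves skewness, so the component of e_(1,0) is everything.

    Since [b ^ a] is the right conjugate, the left action of a on b is written
    [b ^ a^-1]. *)

Lemma conjgV_eq (G : groupType) (a b c : G) : a * b = c * a -> b ^ a^-1 = c.
Proof. by move=> ab; rewrite conjgE invgK mulgA ab mulgK. Qed.

(** * Lifting primitive vectors along the Euclidean algorithm *)

Section FareyLift.
Variables (G : groupType) (x y : G).
Hypothesis braid : x * y * x = y * x * y.

Local Notation D := (x * y * x).

(** Conjugation by the half twist [D] exchanges the two generators, hence acts on
    the whole construction below as the rotation of the plane. *)
Lemma conj_half_twist_l : x ^ D^-1 = y.
Proof. by apply: conjgV_eq; rewrite !mulgA -braid. Qed.

Lemma conj_half_twist_r : y ^ D^-1 = x.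
Proof. by apply: conjgV_eq; rewrite -!mulgA (mulgA y) -braid !mulgA. Qed.

(** The two ways of reaching the vector (1,1), from (0,1) by a shear and from
    (1,0) by an inverse coshear, give the same lift. *)
Lemma conj_braid : y ^ x^-1 = x ^ y.
Proof.
by apply: conjgV_eq; apply: (mulgI y); rewrite !mulgA mulgV mul1g -braid.
Qed.

(** The subtractive Euclidean algorithm on (m,n), with [k] bounding the number of
    steps.  The lift of (1,0) is [x] and that of (0,1) is [y]; undoing a
    subtraction acts by [x] or by the inverse of [y].  The algorithm runs on
    arbitrary pairs, and the value at (0,0) is a default. *)
Fixpoint farey_fuel (k m n : nat) : G :=
  if k is k'.+1 then
    if n == 0 then x else if m == 0 then y
    else if n <= m then farey_fuel k' (m - n) n ^ x^-1
    else farey_fuel k' m (n - m) ^ y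
  else x.

Definition farey_nat (m n : nat) : G := farey_fuel (m + n) m n.

Lemma farey_fuelE k m n : m + n <= k -> farey_fuel k m n = farey_nat m n.
Proof.
rewrite /farey_nat; move: {2}(m + n)%N (leqnn (m + n)) => l.
elim: l k m n => [|l IHl] [|k] m n /= le_l le_k.
- by have [-> ->] : m = 0 /\ n = 0 by lia.
- by have [-> ->] : m = 0 /\ n = 0 by lia.
- by have [-> ->] : m = 0 /\ n = 0 by lia.
case: n le_l le_k => [|n] le_l le_k /=; first by rewrite addn0; case: m le_l le_k.
case: m le_l le_k => [|m] le_l le_k //=.
by case: ifP => le_nm; congr (_ ^ _); rewrite [LHS]IHl ?[RHS]IHl //; lia.
Qed.

Lemma farey_natE m n :
  farey_nat m n = if n == 0 then x else if m == 0 then y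
    else if n <= m then farey_nat (m - n) n ^ x^-1 else farey_nat m (n - m) ^ y.
Proof.
rewrite -(farey_fuelE (leqnSn _)) /=.
case: eqVneq => // n_neq0; case: eqVneq => // m_neq0.
by case: leqP => le_mn; rewrite farey_fuelE //; lia.
Qed.

Lemma farey_nat0r m : farey_nat m 0 = x.
Proof. by rewrite farey_natE. Qed.

Lemma farey_nat0l n : 0 < n -> farey_nat 0 n = y.
Proof. by rewrite farey_natE; case: n. Qed.

Lemma farey_natDl m n : farey_nat (m + n) n = farey_nat m n ^ x^-1.
Proof.
case: n => [|n]; first by rewrite !farey_nat0r conjgE mulgV mulg1 invgK.
by rewrite [LHS]farey_natE addn_eq0 /= andbF leq_addl addnK.
Qed.

(** The algorithm prefers to subtract the second coordinate, so this is not an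
    unfolding when [n = 0]: that case is [conj_braid]. *)
Lemma farey_natDr m n : 0 < m + n -> farey_nat m (n + m) = farey_nat m n ^ y.
Proof.
case: m => [|m mn_gt0].
  by move=> n_gt0; rewrite addn0 farey_nat0l // conjgE mulKg.
case: n mn_gt0 => [|n] _.
  rewrite -[X in farey_nat X _]add0n farey_natDl farey_nat0l // farey_nat0r.
  exact: conj_braid.
rewrite [LHS]farey_natE addnK addn_eq0 /=.
by rewrite (_ : (n.+1 + m.+1 <= m.+1)%N = false) //; lia.
Qed.

(** The full twist is central in the subgroup generated by [x] and [y].  It has to
    fix all lifts, since the square of the rotation is -1. *)
Lemma farey_nat_full_twist m n : (farey_nat m n ^ D^-1) ^ D^-1 = farey_nat m n.
Proof.
rewrite /farey_nat; move: (m + n)%N => k; elim: k m n => [|k IHk] m n /=.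
  by rewrite conj_half_twist_l conj_half_twist_r.
have lr := (conj_half_twist_l, conj_half_twist_r).
do 3?[case: ifP => _]; rewrite ?lr //.
- by rewrite (conjJg _ x^-1) conjVg lr (conjJg _ y^-1) conjVg lr IHk.
- by rewrite (conjJg _ y) lr (conjJg _ x) lr IHk.
Qed.

Local Open Scope ring_scope.

(** If [a * c < 0] then (a,c) is, up to sign, the image of (|c|,|a|) under the
    rotation (p,q) |-> (q,-p). *)
Definition farey_lift (a c : int) : G :=
  (if (0 <= a * c)%R then farey_nat `|a| `|c| else farey_nat `|c| `|a| ^ D^-1)%g.

Lemma farey_liftN a c : farey_lift (- a) (- c) = farey_lift a c.
Proof. by rewrite /farey_lift mulrNN !abszN. Qed.

Lemma farey_lift_nat (m n : nat) : farey_lift m%:Z n%:Z = farey_nat m n.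
Proof. by []. Qed.

(** On the two coordinate axes, shared by both quadrants, the two candidate
    values agree because the half twist exchanges [x] and [y]. *)
Lemma farey_lift_opp_nat (m n : nat) : (0 < m + n)%N ->
  farey_lift (- m%:Z) n%:Z = (farey_nat n m ^ D^-1)%g.
Proof.
rewrite /farey_lift abszN !absz_nat => mn_gt0; case: ifP => // mn0.
have [m0|n0] : m = 0%N \/ n = 0%N by nia.
- rewrite m0 in mn_gt0 *.
  by rewrite farey_nat0l // farey_nat0r conj_half_twist_l.
- rewrite n0 addn0 in mn_gt0 *.
  by rewrite farey_nat0l // farey_nat0r conj_half_twist_r.
Qed.

(** A property of vectors up to sign only needs to be checked on the upper half
    plane. *)
Lemma half_plane_ind (P : int -> int -> Prop) :
    (forall a c : int, P (- a) (- c) -> P a c) ->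
    (forall m n : nat, P m%:Z n%:Z) ->
    (forall m n : nat, P (- m%:Z) n%:Z) ->
  forall a c, P a c.
Proof.
move=> PN Pp Pm.
have Pnat a (n : nat) : P a n%:Z.
  by case: (intP a) => [|m|m]; [apply: (Pp 0%N) | apply: Pp | apply: Pm].
move=> a c; case: (intP c) => [|n|n]; [exact: (Pnat a 0%N) | exact: Pnat |].
by apply: PN; rewrite opprK.
Qed.

Lemma farey_lift_rot (a c : int) : (a != 0) || (c != 0) ->
  farey_lift c (- a) = (farey_lift a c ^ D^-1)%g.
Proof.
move: a c; apply: half_plane_ind => [a c|m n|m n].
- rewrite !oppr_eq0 opprK farey_liftN => IHac /IHac <-.
  by rewrite -farey_liftN opprK.
- move=> nz; rewrite -farey_liftN opprK farey_lift_opp_nat ?farey_lift_nat //; lia.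
- move=> nz; rewrite opprK farey_lift_opp_nat ?farey_nat_full_twist //; lia.
Qed.

Lemma farey_lift_shear (a c : int) : (a != 0) || (c != 0) ->
  farey_lift (a + c) c = (farey_lift a c ^ x^-1)%g.
Proof.
move: a c; apply: half_plane_ind => [a c IH|m n|m n] nz.
- by rewrite -farey_liftN opprD IH ?farey_liftN // !oppr_eq0.
- by rewrite -PoszD !farey_lift_nat farey_natDl.
rewrite farey_lift_opp_nat; last by lia.
(* The shear takes (-m,n) into the first quadrant exactly when m <= n. *)
have [le_mn|lt_nm] := leqP m n.
  have [m0|m_gt0] := posnP m.
    rewrite m0 oppr0 farey_nat0r conj_half_twist_l -PoszD farey_lift_nat.
    by rewrite farey_natDl farey_nat0l //; lia.
  rewrite addrC subzn // farey_lift_nat; move: (n - m)%N (subnK le_mn) => k <-.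
  rewrite (farey_natDl k m) addnC farey_natDr; last by lia.
  rewrite (conjJg _ x^-1) conjVg conj_half_twist_l.
  (* Writing the lift as u ^ D^-1 and D as y x y, both sides are
     u ^ (y^-1 x^-1). *)
  by rewrite -{1}farey_nat_full_twist braid -!conjgM !invgM !mulgA mulgVK.
have -> : - m%:Z + n%:Z = - (m - n)%N%:Z by lia.
rewrite farey_lift_opp_nat; last by lia.
rewrite -{2}(subnK (ltnW lt_nm)) farey_natDr; last by lia.
by rewrite (conjJg _ y) conj_half_twist_r conjgK.
Qed.

(** The coshear is the conjugate of the shear by the rotation, as [y] is the
    conjugate of [x] by the half twist. *)
Lemma farey_lift_coshear (a c : int) : (a != 0) || (c != 0) ->
  farey_lift a (c - a) = (farey_lift a c ^ y^-1)%g.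
Proof.
move=> nz.
have := @farey_lift_rot (a - c) a; rewrite opprB => ->; last by lia.
rewrite addrC farey_lift_shear ?oppr_eq0; last by lia.
have <- : (farey_lift (- c) a ^ D^-1)%g = farey_lift a c.
  by rewrite -farey_lift_rot ?opprK // oppr_eq0; lia.
by rewrite (conjJg _ x^-1) conjVg conj_half_twist_l.
Qed.

End FareyLift.

Local Close Scope ring_scope.

(** * Morphisms out of a presented group *)

Section Multiplicative.
Variables (G H : groupType) (F : {multiplicative G -> H}).

Lemma multiplicative1 : F 1 = 1.
Proof. by apply: (mulgI (F 1)); rewrite -gmulfM !mulg1. Qed.

Lemma multiplicativeV u : F u^-1 = (F u)^-1.
Proof. by apply: (mulgI (F u)); rewrite -gmulfM !mulgV multiplicative1. Qed.

Lemma multiplicativeJ u v : F (u ^ v) = F u ^ F v.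
Proof. by rewrite !conjgE !gmulfM multiplicativeV. Qed.

End Multiplicative.

Section PresentedGroup.
Variables (X : choiceType) (rels : word X -> word X -> Prop) (H : groupType).

Local Notation gen z := (pres_class rels (letter z)).

Definition word_eval (f : X -> H) (w : word X) : H :=
  \prod_(l <- w) (if l.2 then (f l.1)^-1 else f l.1).

Lemma word_eval_letter f z : word_eval f (letter z) = f z.
Proof. by rewrite /word_eval big_seq1. Qed.

Lemma word_eval_cat f u v : word_eval f (u ++ v) = word_eval f u * word_eval f v.
Proof. by rewrite /word_eval big_cat. Qed.

Lemma presented_group_lift (f : X -> H) :
    (forall u v, rels u v -> word_eval f u = word_eval f v) ->
  exists F : {multiplicative presented_group rels -> H}, forall z, F (gen z) = f z.
Proof.
move=> f_rels.
have f_eq u v : pres_eq rels u v -> word_eval f u = word_eval f v.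
  elim=> {u v} [//|u v _ ->//|u v w _ -> _ ->//|u u' v v' _ equ _ eqv|z b|//].
  - by rewrite !word_eval_cat equ eqv.
  - rewrite /word_eval big_cons big_seq1 big_nil.
    by case: b => /=; rewrite ?mulVg ?mulgV.
pose F (u : presented_group rels) := word_eval f (repr u).
have F_class u : F (pres_class rels u) = word_eval f u by apply/f_eq/pres_repr.
have FM : {morph F : u v / u * v}.
  elim/presW=> u; elim/presW=> v.
  by rewrite [_ * _]pres_mulE !F_class word_eval_cat.
pose F_mul := isMultiplicative.Build _ _ F FM.
exists (HB.pack_for {multiplicative presented_group rels -> H} F F_mul) => z /=.
by rewrite F_class word_eval_letter.
Qed.

Lemma presented_group_hom_eq (F F' : {multiplicative presented_group rels -> H}) :
  (forall z, F (gen z) = F' (gen z)) -> F =1 F'.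
Proof.
move=> eqF.
elim/presW; elim=> [|[z b] w IHw]; first by rewrite !multiplicative1.
rewrite -cat1s -pres_mulE !gmulfM IHw; congr (_ * _).
case: b; last exact: eqF.
by rewrite (_ : pres_class _ _ = (gen z)^-1) ?multiplicativeV ?eqF // [RHS]pres_invE.
Qed.

End PresentedGroup.

(** * Connectedness by mutually skew pairs *)

Section SkewConnected.
Variable Q : ipQuandleType.
Implicit Types a b c g : Q.

Lemma qactKV a b : qact a (qact (qinv a) b) = b.
Proof. by rewrite -{1}[a]qinvK qactVK. Qed.

Definition skew_connected a b :=
  exists p : seq Q, path (@skew_edge Q) a p /\ last a p = b.

Lemma skew_connected_edge a b : mutually_skew a b -> skew_connected a b.
Proof.
move=> skew_ab; have [<-|neq_ab] := eqVneq a b; first by exists [::].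
by exists [:: b]; rewrite /= /skew_edge neq_ab skew_ab.
Qed.

Lemma skew_connected_trans b a c :
  skew_connected a b -> skew_connected b c -> skew_connected a c.
Proof.
move=> [p [path_p <-]] [q [path_q <-]].
by exists (p ++ q); rewrite cat_path path_p path_q last_cat.
Qed.

Lemma skew_connected_sym a b : skew_connected a b -> skew_connected b a.
Proof.
move=> [p [path_p <-]]; elim: p a path_p => [|c p IHp] a /=.
  by exists [::].
case/andP=> /andP[_ skew_ac] /IHp/skew_connected_trans; apply.
by apply: skew_connected_edge; rewrite mutually_skewC.
Qed.

Lemma skew_connectedJ g a b :
  skew_connected a b -> skew_connected (qact g a) (qact g b).
Proof.
have skewJ c d : mutually_skew c d -> mutually_skew (qact g c) (qact g d).
  by move=> /eqP skew_cd; apply/eqP; rewrite -!qactA skew_cd qactV.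
move=> [p [path_p <-]]; elim: p a path_p => [|c p IHp] a /=.
  by exists [::].
case/andP=> /andP[_ /skewJ/skew_connected_edge] + /IHp.
exact: skew_connected_trans.
Qed.

Lemma skew_connectedV a : skew_connected a (qinv a).
Proof.
apply/skew_connected_edge/eqP.
by rewrite qactV qactxx -[in LHS](qactVK a a) qactxx.
Qed.

End SkewConnected.

(** * IP-quandles generated by a braid pair *)

(** The equation is the braid relation: when the action is conjugation it says
    that (yx) y = x (yx).  Only one of the generators occurs as a base case,
    because the equation makes them conjugate. *)
Record braid_generated (Q : ipQuandleType) (x y : Q) : Prop := BraidGenerated {
  braid_gen_eq : qact y (qact x y) = x;
  braid_gen_ind : forall P : Q -> Prop, P x ->
    (forall b, P b -> P (qact x b)) -> (forall b, P b -> P (qact y b)) ->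
    (forall b, P b -> P (qinv b)) -> forall b, P b
}.

Section BraidGenerated.
Variables (Q : ipQuandleType) (x y : Q).
Hypothesis xy_gen : braid_generated x y.

Lemma braid_generated_locally_skew : locally_skew Q.
Proof.
have [yxy ind] := xy_gen.
have con_xy : skew_connected x y.
  rewrite -[y]qinvK; apply: skew_connected_trans (skew_connectedV _).
  apply/skew_connected_edge/eqP.
  by rewrite -{2}yxy qactVK qactV.
suff con_x b : skew_connected x b.
  by move=> a b; apply: skew_connected_trans (con_x b); apply: skew_connected_sym.
elim/ind: b => [|b con_b|b con_b|b con_b].
- by exists [::].
- by rewrite -[x in skew_connected x]qactxx; apply: skew_connectedJ.
- apply: skew_connected_trans (skew_connectedJ y con_b).
  apply: (skew_connected_trans con_xy); rewrite -[y in skew_connected y]qactxx.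
  exact/skew_connectedJ/skew_connected_sym.
- exact: skew_connected_trans con_b (skew_connectedV b).
Qed.

(** Equivariance is only asked for the two generators; that [lam] turns the whole
    quandle action into conjugation is [braid_liftJ]. *)
Record braid_lift (G : groupType) (s t : G) (lam : Q -> G) : Prop := BraidLift {
  braid_lift_x : lam x = s;
  braid_liftJx : forall b, lam (qact x b) = lam b ^ s^-1;
  braid_liftJy : forall b, lam (qact y b) = lam b ^ t^-1;
  braid_liftV : forall b, lam (qinv b) = (lam b)^-1
}.

Section Lift.
Variables (G : groupType) (s t : G) (lam : Q -> G).
Hypotheses (braid : s * t * s = t * s * t) (lamP : braid_lift s t lam).

Lemma braid_lift_y : lam y = t.
Proof.
have [lam_x lamJx lamJy _] := lamP; have [yxy _] := xy_gen.
apply: (@conjg_inj _ s^-1); apply: (@conjg_inj _ t^-1).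
rewrite -lamJx -lamJy yxy lam_x; apply/esym.
rewrite -conjgM -invgM; apply: conjgV_eq.
by rewrite mulgA braid.
Qed.

(** The elements [a] for which this holds for all [b] are closed under the
    generating operations, since acting by (x acting on a) is acting by the
    inverse of x, then by a, then by x. *)
Lemma braid_liftJ a b : lam (qact a b) = lam b ^ (lam a)^-1.
Proof.
have [lam_x lamJx lamJy lamV] := lamP; have [_ ind] := xy_gen.
elim/ind: a b => [|a IHa|a IHa|a IHa] b.
- by rewrite lam_x.
- rewrite -(qactKV x b) -qactA !lamJx IHa -conjVg.
  exact: conjJg.
- rewrite -(qactKV y b) -qactA !lamJy IHa -conjVg.
  exact: conjJg.
- by rewrite lamV -{2}(qactKV a b) IHa conjgK.
Qed.

End Lift.

End BraidGenerated.

(** * The group of such a quandle *)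

Definition sigma (i : 'I_2) : braid_group 3 :=
  pres_class (@braid_rels 3) (letter i).

Lemma sigma_braid :
  sigma 0%R * sigma 1%R * sigma 0%R = sigma 1%R * sigma 0%R * sigma 1%R.
Proof.
have sigma3 i j k : sigma i * sigma j * sigma k
    = pres_class (@braid_rels 3) (letter i ++ letter j ++ letter k).
  by rewrite -!pres_mulE; apply/esym/(@mulgA (braid_group 3)).
rewrite !sigma3; apply/pres_classP/PresRel.
exact: (@BraidAdjacent 3 0%R 1%R).
Qed.

Section GroupOfBraidGenerated.
Variables (Q : ipQuandleType) (x y : Q).
Hypothesis xy_gen : braid_generated x y.

Local Notation gen :=
  (fun a : Q => pres_class (@ipq_rels Q) (letter a) : ipq_group Q).

Lemma ipq_genJ a b : gen (qact a b) = gen b ^ (gen a)^-1.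
Proof.
apply/esym/conjgV_eq; rewrite ![_ * _]pres_mulE.
exact/esym/pres_classP/PresRel/IPQConj.
Qed.

Lemma ipq_genV a : gen (qinv a) = (gen a)^-1.
Proof.
apply: (mulIg (gen a)); rewrite mulVg [LHS]pres_mulE.
exact/pres_classP/PresRel/IPQInv.
Qed.

Lemma ipq_gen_braid : gen x * gen y * gen x = gen y * gen x * gen y.
Proof.
have [yxy _] := xy_gen.
have := ipq_genJ y (qact x y); rewrite yxy ipq_genJ -conjgM -invgM => gx.
by rewrite -mulgA {1}gx -conjgCV.
Qed.

(** Sending the generator [a] to [lam a], and the braid generators to [x] and [y],
    gives morphisms both ways.  They are inverse on generators: for B_3 at once,
    for the group of the quandle by induction over the quandle. *)
Lemma braid_generated_iso (lam : Q -> braid_group 3) :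
    braid_lift x y (sigma 0%R) (sigma 1%R) lam ->
  isomorphic_groups (ipq_group Q) (braid_group 3).
Proof.
move=> lamP; have [lam_x lamJx lamJy lamV] := lamP.
have lamJ := braid_liftJ xy_gen lamP.
have [F F_gen] : exists F : {multiplicative ipq_group Q -> braid_group 3},
    forall a, F (gen a) = lam a.
  apply: presented_group_lift => _ _ [a b|a].
    by rewrite !word_eval_cat !word_eval_letter lamJ -conjgCV.
  by rewrite word_eval_cat !word_eval_letter lamV mulVg /word_eval big_nil.
pose g (i : 'I_2) := if i == 0%R then gen x else gen y.
have [K K_gen] : exists K : {multiplicative braid_group 3 -> ipq_group Q},
    forall i, K (sigma i) = g i.
  apply: (@presented_group_lift _ _ (ipq_group Q)) => _ _ [i j lt_ij|i j eq_ij].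
    by case: j lt_ij => [[|[]]].
  have [-> ->] : i = 0%R /\ j = 1%R.
    case: i j eq_ij => [[|[]] // lti] [[|[]] // ltj] //= _.
    by split; apply: val_inj.
  rewrite !word_eval_cat !word_eval_letter /g /= !mulgA.
  exact: ipq_gen_braid.
exists F; exists K.
- move=> u.
  apply: (@presented_group_hom_eq _ _ (ipq_group Q) (K \o F) idfun) => a /=.
  rewrite F_gen; have [_ ind] := xy_gen.
  elim/ind: a => [|b IHb|b IHb|b IHb].
  + by rewrite lam_x K_gen.
  + by rewrite lamJx multiplicativeJ multiplicativeV K_gen IHb ipq_genJ.
  + by rewrite lamJy multiplicativeJ multiplicativeV K_gen IHb ipq_genJ.
  + by rewrite lamV multiplicativeV IHb ipq_genV.
- move=> u.
  apply: (@presented_group_hom_eq _ _ (braid_group 3) (F \o K) idfun) => i /=.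
  rewrite -/(sigma i) K_gen /g.
  case: eqP => [->|neq_i]; rewrite F_gen.
    exact: lam_x.
  rewrite (braid_lift_y xy_gen sigma_braid lamP); congr sigma.
  case: i neq_i => [[|[|//]] lt_i] neq_i; apply: val_inj => //.
  by case: neq_i; apply: val_inj.
Qed.

End GroupOfBraidGenerated.

(** * The quandle of primitive vectors *)

Local Open Scope ring_scope.

(** The Euclidean algorithm: reduce [a] modulo [c] by shears, then rotate so that
    the remainder becomes the second coordinate.  The square of the rotation is
    -1, so the two signs of (1,0) are both reached. *)
Lemma coprimez_ind (P : int -> int -> Prop) :
    P 1 0 -> (forall a c, P a c -> P (a + c) c) ->
    (forall a c, P a c -> P c (- a)) ->
  forall a c, coprimez a c -> P a c.
Proof.
move=> P10 Pshear Prot.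
have PN a c : P a c -> P (- a) (- c) by move=> /Prot/Prot.
have PshearV a c : P a c -> P (a - c) c.
  (* The inverse shear is S U S U S for the rotation S and the shear U, because
     (S U)^3 = 1. *)
  move=> /Prot/Pshear/Prot/Pshear/Prot.
  by congr P; ring.
have Pshears k a c : P a c -> P (a + k * c) c.
  elim/int_rec: k => [|k IHk|k IHk] Pac; first by rewrite mul0r addr0.
    by move/IHk/Pshear: Pac; congr P; rewrite intS; ring.
  by move/IHk/PshearV: Pac; congr P; rewrite intS; ring.
suff main m : forall a c : int, (`|c| < m)%N -> coprimez a c -> P a c.
  by move=> a c; apply: (main `|c|.+1).
elim: m => [//|m IHm] a c lt_cm co_ac.
have [c0|c_neq0] := eqVneq c 0.
  move: co_ac; rewrite c0 /coprimez gcdz0; case: (intP a) => // n.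
    by move=> /eqP[->].
  by rewrite abszN => /eqP[->]; apply: (PN 1 0).
rewrite (divz_eq a c) addrC; apply: Pshears.
rewrite -[c in P _ c]opprK; apply: Prot; apply: IHm.
  rewrite -ltz_nat gez0_abs ?modz_ge0 //.
  by apply: Order.POrderTheory.lt_le_trans (ltz_mod _ c_neq0) _; lia.
by rewrite /coprimez gcdNz gcdzC gcdz_modl.
Qed.

Lemma evec_quandle_subproof a c : coprimez a c -> evec a c \in ZP1_set.
Proof. by move=> co_ac; apply/asboolP; exists a, c; split; [|left]. Qed.

Definition evecq a c (co_ac : coprimez a c) : ZP1_quandle :=
  exist _ (evec a c) (evec_quandle_subproof co_ac).

Definition evec10 : ZP1_quandle := evecq (isT : coprimez 1 0).
Definition evec01 : ZP1_quandle := evecq (isT : coprimez 0 1).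

Lemma evecJ_upper a c : (evec 1 0 * evec a c * (evec 1 0)^-1)%g = evec (a + c) c.
Proof. by rewrite evecJ !mxE /=; congr evec; ring. Qed.

Lemma evecJ_lower a c : (evec 0 1 * evec a c * (evec 0 1)^-1)%g = evec a (c - a).
Proof. by rewrite evecJ !mxE /=; congr evec; ring. Qed.

(** The orbit of (1,0) under the shear and the coshear contains all primitive
    vectors, and the other elements of the quandle are inverses. *)
Lemma evecq_ind (P : ZP1_quandle -> Prop) :
    P evec10 -> (forall b, P b -> P (qact evec10 b)) ->
    (forall b, P b -> P (qact evec01 b)) -> (forall b, P b -> P (qinv b)) ->
  forall b, P b.
Proof.
move=> P10 PJ10 PJ01 PV.
pose Pvec a c := forall b : ZP1_quandle, val b = evec a c -> P b.
have Pshear a c : Pvec a c -> Pvec (a + c) c.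
  move=> Pac b b_val; rewrite -(qactKV evec10 b); apply/PJ10/Pac.
  by rewrite /= b_val -evecJ_upper invgK mulgA mulgVK mulgA mulVg mul1g.
have Pcoshear a c : Pvec a c -> Pvec a (c - a).
  move=> Pac b b_val; rewrite -(qactKV evec01 b); apply/PJ01/Pac.
  by rewrite /= b_val -evecJ_lower invgK mulgA mulgVK mulgA mulVg mul1g.
have Pe : forall a c, coprimez a c -> Pvec a c.
  (* Shear, coshear, shear compose to the rotation. *)
  apply: coprimez_ind => // [b b_val|a c /Pshear/Pcoshear/Pshear].
    by rewrite (_ : b = evec10) //; apply: val_inj.
  by congr Pvec; ring.
move=> b; have /asboolP[a [c [co_ac [b_val|b_val]]]] := valP b.
  exact: Pe b_val.
by rewrite -(qinvK b); apply/PV/(Pe _ _ co_ac); rewrite /= b_val invgK.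
Qed.

Lemma ZP1_braid_generated : braid_generated evec10 evec01.
Proof.
split; last exact: evecq_ind.
by apply: val_inj; rewrite /= evecJ_upper evecJ_lower.
Qed.

Lemma evec_sq_inj a c a' c' : evec a c = evec a' c' ->
  [/\ a ^+ 2 = a' ^+ 2, c ^+ 2 = c' ^+ 2 & a * c = a' * c'].
Proof.
move=> eq_e.
have := congr1 (fun A : SL 2 int => A 0 0) eq_e.
have := congr1 (fun A : SL 2 int => A 0 1) eq_e.
have := congr1 (fun A : SL 2 int => A 1 0) eq_e.
rewrite !mxE /= => /oppr_inj -> ->.
by move/addrI/oppr_inj.
Qed.

(** The sign of the off-diagonal entries separates the two conjugacy classes. *)
Lemma evec_neqV a c a' c' : coprimez a c -> evec a c <> (evec a' c')^-1%g.
Proof.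
move=> co_ac /(congr1 (@slval _ _)) eq_e; move: (eq_e); rewrite evecV.
move/matrixP=> E; have := E 0 1; have := E 1 0; rewrite !mxE /=.
move=> c2 a2; have [a0 c0] : a = 0 /\ c = 0 by split; nia.
by rewrite a0 c0 in co_ac.
Qed.

Section ZP1Lift.
Variables (G : groupType) (s t : G).
Hypothesis braid : (s * t * s = t * s * t)%g.

Lemma farey_lift_evec a c a' c' : evec a c = evec a' c' ->
  farey_lift s t a c = farey_lift s t a' c'.
Proof.
case/evec_sq_inj=> a2 c2 ac.
have abs_sqr (u v : int) : u ^+ 2 = v ^+ 2 -> `|u|%N = `|v|%N.
  by move/eqP; rewrite eqf_sqr => /orP[]/eqP->; rewrite ?abszN.
by rewrite /farey_lift ac (abs_sqr a a') // (abs_sqr c c').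
Qed.

(** A matrix determines its vector up to sign and whether it is inverted, hence
    the value of the lift, so the choice of a vector for each element of the
    quandle is harmless. *)
Lemma ZP1_lift_exists : exists lam, braid_lift evec10 evec01 s t lam.
Proof.
pose lifts (b : ZP1_quandle) (g : G) : Prop := exists a c, coprimez a c /\
  ((val b = evec a c /\ g = farey_lift s t a c) \/
   (val b = (evec a c)^-1%g /\ g = (farey_lift s t a c)^-1%g)).
have lifts_total b : exists g, lifts b g.
  have /asboolP[a [c [co_ac [b_val|b_val]]]] := valP b.
    by exists (farey_lift s t a c), a, c; split=> //; left.
  by exists (farey_lift s t a c)^-1%g, a, c; split=> //; right.
have lifts_inj b g g' : lifts b g -> lifts b g' -> g = g'.
  move=> [a [c [co_ac [[b_val ->]|[b_val ->]]]]];
  move=> [a' [c' [co_ac' [[+ ->]|[+ ->]]]]]; rewrite b_val => e.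
  - exact: farey_lift_evec.
  - by case: (evec_neqV co_ac e).
  - by case: (evec_neqV co_ac' (esym e)).
  - by congr (_^-1)%g; apply: farey_lift_evec; apply: invg_inj.
have [lam lamP] := choice lifts_total.
have lamE b g : lifts b g -> lam b = g by apply: lifts_inj.
have nz a c : coprimez a c -> (a != 0) || (c != 0).
  by apply: contraTT; rewrite negb_or !negbK => /andP[/eqP-> /eqP->].
exists lam; split.
- by apply: lamE; exists 1, 0; split=> //; left; rewrite /farey_lift.
- move=> b; apply: lamE; have [a [c [co_ac e]]] := lamP b.
  exists (a + c), c; split; first by rewrite /coprimez gcdzC gcdzDr gcdzC.
  case: e => [[b_val ->]|[b_val ->]]; [left|right]; rewrite /= b_val -evecJ_upper.
    by rewrite farey_lift_shear ?nz.
  by rewrite farey_lift_shear ?nz // conjVg !invgM invgK mulgA.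
- move=> b; apply: lamE; have [a [c [co_ac e]]] := lamP b.
  exists a, (c - a); split; first by rewrite /coprimez -gcdzDr subrK.
  case: e => [[b_val ->]|[b_val ->]]; [left|right]; rewrite /= b_val -evecJ_lower.
    by rewrite farey_lift_coshear ?nz.
  by rewrite farey_lift_coshear ?nz // conjVg !invgM invgK mulgA.
- move=> b; apply: lamE; have [a [c [co_ac e]]] := lamP b.
  exists a, c; split=> //.
  by case: e => [[b_val ->]|[b_val ->]]; [right|left]; rewrite /= b_val ?invgK.
Qed.

End ZP1Lift.

Theorem proposition4p1 :
  locally_skew ZP1_quandle /\
  isomorphic_groups (ipq_group ZP1_quandle) (braid_group 3).
Proof.
split; first exact: braid_generated_locally_skew ZP1_braid_generated.
have [lam lamP] := ZP1_lift_exists sigma_braid.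
exact: (braid_generated_iso ZP1_braid_generated lamP).
Qed.
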